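(* Let $n\ge 1$ and let $R_1,\ldots,R_n$ be commutative rings with unity with $k_i=\chi(R_i)<\infty$ for $1\le i\le n$. For each $i$, let $U^i_1,U^i_2,\ldots,U^i_{k_i}$ be the color classes of a proper coloring of $R_i$ with $k_i$ colors, and let $s_i$ be the number of indices $m\in\{1,\ldots,k_i\}$ such that $U^i_m$ contains an element $x$ with $x^2=0$. Then $$\sum_{i=1}^n\chi(R_i)-(n-1)\le \chi(R_1\times R_2\times\cdots\times R_n)\le \sum_{i=1}^n(\chi(R_i)-s_i)+s_1s_2\cdots s_n.$$
   Context: All rings are commutative with unity (not necessarily finite). A ring $R$ is regarded as a simple graph whose vertices are all elements of $R$ (including $0$), two distinct vertices $x,y$ being adjacent if and only if $xy=0$. A proper coloring of $R$ is a partition of $R$ into color classes, each of which is an independent set ($xy\ne 0$ for distinct $x,y$ in the class). The chromatic number $\chi(R)$ is the minimum number of color classes in a proper coloring of $R$. *)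

(* Defs.v *)
From HB Require Import structures.
From mathcomp Require Import all_boot all_order all_algebra.
From mathcomp Require Import all_classical.

Set Implicit Arguments.
Unset Strict Implicit.
Unset Printing Implicit Defensive.

Import Order.TTheory GRing.Theory Num.Theory.

Local Open Scope classical_set_scope.
Local Open Scope ring_scope.

Definition ring_adj (R : comPzRingType) (x y : R) : Prop :=
  x <> y /\ x * y = 0.

Definition independent (R : comPzRingType) (A : set R) : Prop :=
  forall x y, A x -> A y -> ~ ring_adj x y.

(* [partition] also requires every class [U m] to be nonempty, so [k] is
   exactly the number of color classes. *)
Definition proper_coloring (R : comPzRingType) (k : nat) (U : 'I_k -> set R)
  : Prop :=
  partition [set: 'I_k] U [set: R] /\ forall m, independent (U m).

(* chi(R) = k < oo, as a relation because chi(R) may be infinite. *)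
Definition chromatic_number_is (R : comPzRingType) (k : nat) : Prop :=
  (exists U : 'I_k -> set R, proper_coloring U) /\
  forall j (U : 'I_j -> set R), proper_coloring U -> (k <= j)%N.

Lemma chromatic_number_is_inj (R : comPzRingType) (k l : nat) :
  chromatic_number_is R k -> chromatic_number_is R l -> k = l.
Proof.
move=> [[U hU] minU] [[V hV] minV]; apply/eqP.
by rewrite eqn_leq (minU _ V hV) (minV _ U hU).
Qed.

Definition num_square_zero_classes (R : comPzRingType) (k : nat)
    (U : 'I_k -> set R) : nat :=
  #|[set m : 'I_k | `[< exists2 x, U m x & x ^+ 2 = 0 >]]%SET|.

(* The library's ring structure on finite functions is only for a constant
   codomain, hence this dependent version of the componentwise operations. *)
Definition prod_ring (n : nat) (R : 'I_n -> comPzRingType) : Type :=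
  {dffun forall i : 'I_n, R i}.

Section ProdRing.
Variables (n : nat) (R : 'I_n -> comPzRingType).
Implicit Types x y z : prod_ring R.

HB.instance Definition _ := Choice.on (prod_ring R).

Definition prod_ring_zero : prod_ring R := [ffun i => 0 : R i].
Definition prod_ring_one : prod_ring R := [ffun i => 1 : R i].
Definition prod_ring_opp x : prod_ring R := [ffun i => - x i].
Definition prod_ring_add x y : prod_ring R := [ffun i => x i + y i].
Definition prod_ring_mul x y : prod_ring R := [ffun i => x i * y i].

Fact prod_ring_addA : associative prod_ring_add.
Proof. by move=> x y z; apply/ffunP=> i; rewrite !ffunE addrA. Qed.
Fact prod_ring_addC : commutative prod_ring_add.
Proof. by move=> x y; apply/ffunP=> i; rewrite !ffunE addrC. Qed.
Fact prod_ring_add0 : left_id prod_ring_zero prod_ring_add.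
Proof. by move=> x; apply/ffunP=> i; rewrite !ffunE add0r. Qed.
Fact prod_ring_addN : left_inverse prod_ring_zero prod_ring_opp prod_ring_add.
Proof. by move=> x; apply/ffunP=> i; rewrite !ffunE addNr. Qed.

HB.instance Definition _ := GRing.isZmodule.Build (prod_ring R)
  prod_ring_addA prod_ring_addC prod_ring_add0 prod_ring_addN.

Fact prod_ring_mulA : associative prod_ring_mul.
Proof. by move=> x y z; apply/ffunP=> i; rewrite !ffunE mulrA. Qed.
Fact prod_ring_mulC : commutative prod_ring_mul.
Proof. by move=> x y; apply/ffunP=> i; rewrite !ffunE mulrC. Qed.
Fact prod_ring_mul1 : left_id prod_ring_one prod_ring_mul.
Proof. by move=> x; apply/ffunP=> i; rewrite !ffunE mul1r. Qed.
Fact prod_ring_mulD : left_distributive prod_ring_mul prod_ring_add.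
Proof. by move=> x y z; apply/ffunP=> i; rewrite !ffunE mulrDl. Qed.

HB.instance Definition _ := GRing.Zmodule_isComPzRing.Build (prod_ring R)
  prod_ring_mulA prod_ring_mulC prod_ring_mul1 prod_ring_mulD.

Lemma prod_ring_mulE x y i : (x * y) i = x i * y i.
Proof. by rewrite ffunE. Qed.

Lemma prod_ring_zeroE i : (0 : prod_ring R) i = 0.
Proof. by rewrite ffunE. Qed.

End ProdRing.

(* Main.v *)
Require Import Defs.
From mathcomp Require Import all_boot all_order all_algebra.
From mathcomp Require Import all_classical.
From mathcomp Require Import zify.

(** Both bounds are cleanest for coloring maps, which give distinct adjacent
    elements distinct colors, rather than for partitions: by
    [chromatic_number_le] the chromatic number is at most the size of any
    finite set that contains all values of such a map, so that color classes
    can be forgotten as soon as [coloring_map_exists] has read off a map.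

    Lower bound ([chromatic_number_prod_ge]).  Embed each [R i] in the product
    along its coordinate axis.  Nonzero elements of two different axes are
    distinct with product zero, so the axes use disjoint sets of colors for
    their nonzero elements.  Zero is adjacent to everything else, so its color
    is in none of these sets.  Restricting the coloring to one axis colors
    [R i] ([card_axis_colors]), hence the nonzero part of that axis sees at
    least [k i - 1] colors; adding up, there are at least
    [1 + \sum_i (k i - 1)] colors.

    Upper bound ([prod_color_proper], [card_prod_color_set]).  Two elements in
    the same class of [R i] have nonzero product, unless they are equal and
    square to zero.  So if some coordinate [x i] lies in a class without
    square-zero element, the pair of [i] and that class is already a legitimate
    color for [x]: the product of any two elements with this color is nonzero
    at [i].  There are [\sum_i (k i - s i)] such pairs.  The remaining [x] have all
    coordinates in classes that contain a square-zero element, and are colored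
    by the tuple of these classes; distinct elements with the same tuple differ
    at some coordinate, where the product is nonzero.  There are [\prod_i s i]
    such tuples. *)

Set Implicit Arguments.
Unset Strict Implicit.
Unset Printing Implicit Defensive.

Import Order.TTheory GRing.Theory Num.Theory.

Local Open Scope ring_scope.

(** * Colorings as maps *)

Definition coloring_map (R : comPzRingType) (T : Type) (f : R -> T) : Prop :=
  forall x y, f x = f y -> ~ ring_adj x y.

Lemma coloring_map_exists (R : comPzRingType) (k : nat) (U : 'I_k -> set R) :
  proper_coloring U ->
  exists2 f : R -> 'I_k, forall x, U (f x) x & coloring_map f.
Proof.
move=> [[covU _ _] indU].
have /choice[f fP] : forall x, exists m, U m x.
  move=> x; have [m _ Umx] : cover [set: 'I_k]%classic U x by rewrite covU.
  by exists m.
exists f => // x y fxy; apply: (indU (f x)); first exact: fP.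
by rewrite fxy; exact: fP.
Qed.

(** The classes are the fibers over the attained colors only, since classes
    have to be nonempty. *)
Lemma proper_coloring_of_map (R : comPzRingType) (T : finType) (f : R -> T)
    (A : {set T}) :
  coloring_map f -> (forall x, f x \in A) ->
  exists j (U : 'I_j -> set R), proper_coloring U /\ (j <= #|A|)%N.
Proof.
move=> fcol fA; pose B := [set t | `[< exists x, f x = t >]]%SET.
have fB x : f x \in B by rewrite inE; apply/asboolP; exists x.
pose V (m : 'I_#|B|) : set R := [set x | f x = enum_val m]%classic.
exists #|B|, V; split; last first.
  by apply/subset_leq_card/fintype.subsetP => t; rewrite inE => /asboolP[x <-].
split=> [|m x y /= fx fy]; last by apply: fcol; rewrite fx.
split.
- apply/seteqP; split=> // x _.
  by exists (enum_rank_in (fB x) (f x)); rewrite // /V /= enum_rankK_in.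
- move=> a b _ _ [x /= [fxa fxb]]; apply: enum_val_inj; by rewrite -fxa.
- move=> m _; have := enum_valP m; rewrite inE => /asboolP[x fx].
  by exists x.
Qed.

Lemma chromatic_number_le (R : comPzRingType) (T : finType) (f : R -> T)
    (A : {set T}) (k : nat) :
  coloring_map f -> (forall x, f x \in A) -> chromatic_number_is R k ->
  (k <= #|A|)%N.
Proof.
move=> fcol fA [_ kmin].
have [j [U [Ucol jA]]] := proper_coloring_of_map fcol fA.
exact: leq_trans (kmin _ _ Ucol) jA.
Qed.

Lemma chromatic_number_exists (R : comPzRingType) (T : finType) (f : R -> T) :
  coloring_map f -> exists c, chromatic_number_is R c.
Proof.
move=> fcol.
have [j [U [Ucol _]]] :=
  proper_coloring_of_map fcol (fun x => finset.in_setT (f x)).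
pose colorable l := `[< exists V : 'I_l -> set R, proper_coloring V >].
have ex : exists l, colorable l by exists j; apply/asboolP; exists U.
have [c /asboolP ccol cmin] := ex_minnP ex.
by exists c; split=> // l V Vcol; apply: cmin; apply/asboolP; exists V.
Qed.

Section Product.
Variables (n : nat) (R : 'I_n -> comPzRingType).

(** * The lower bound *)

Definition axis (i : 'I_n) (x : R i) : prod_ring R :=
  [ffun l => eqtype.dfwith (fun l => 0 : R l) x l].

Lemma axis_in i (x : R i) : axis x i = x.
Proof. by rewrite ffunE dfwith_in. Qed.

Lemma axis_out i l (x : R i) : i != l -> axis x l = 0.
Proof. by move=> il; rewrite ffunE dfwith_out. Qed.

Lemma axis_inj i : injective (@axis i).
Proof. by move=> x y xy; rewrite -(axis_in x) xy axis_in. Qed.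

Lemma axis0 i : axis (0 : R i) = 0.
Proof.
apply/ffunP => l; rewrite prod_ring_zeroE.
have [<-|il] := eqVneq i l; first exact: axis_in.
exact: axis_out.
Qed.

Lemma axisM i (x y : R i) : axis x * axis y = axis (x * y).
Proof.
apply/ffunP => l; rewrite prod_ring_mulE.
have [<-|il] := eqVneq i l; first by rewrite !axis_in.
by rewrite !axis_out // mul0r.
Qed.

Lemma axis_orthogonal i l (x : R i) (y : R l) :
  i != l -> axis x * axis y = 0.
Proof.
move=> il; apply/ffunP => a; rewrite prod_ring_mulE prod_ring_zeroE.
have [<-|ia] := eqVneq i a; last by rewrite (axis_out x ia) mul0r.
by rewrite (axis_out y) ?mulr0 // eq_sym.
Qed.

Section AxisColors.
Variables (T : finType) (f : prod_ring R -> T).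
Hypothesis fcol : coloring_map f.

Definition axis_colors (i : 'I_n) : {set T} :=
  [set t | `[< exists2 x : R i, x <> 0 & f (axis x) = t >]]%SET.

(** A common color of two axes would be shared by two nonzero vectors, one on
    each axis; these are distinct and orthogonal, hence adjacent. *)
Lemma axis_colors_disjoint i l :
  i != l -> [disjoint axis_colors i & axis_colors l].
Proof.
move=> il; apply/pred0P => t /=; apply/negbTE/negP; rewrite !inE.
move=> /andP[/asboolP[x x0 fx] /asboolP[y y0 fy]].
apply: (fcol (etrans fx (esym fy))); split; last exact: axis_orthogonal.
move=> xy; apply: x0; by rewrite -(axis_in x) xy axis_out // eq_sym.
Qed.

(** Zero is adjacent to every other element, so its color class is [{0}]. *)
Lemma color0_notin_axis_colors i : f 0 \notin axis_colors i.
Proof.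
rewrite inE; apply/asboolP => -[x x0 fx]; apply: (fcol fx).
by split; [rewrite -(axis0 i) => /axis_inj | rewrite mulr0].
Qed.

(** The axis embedding preserves adjacency, so the coloring pulls back to
    [R i]; the extra color is the one of zero. *)
Lemma card_axis_colors i (k : nat) :
  chromatic_number_is (R i) k -> (k <= #|axis_colors i|.+1)%N.
Proof.
move=> kP.
have -> : #|axis_colors i|.+1 = #|f 0 |: axis_colors i|%SET.
  by rewrite cardsU1 color0_notin_axis_colors.
apply: (@chromatic_number_le _ _ (f \o @axis i)) kP => [x y /= fxy [xy xy0]|x].
  apply: (fcol fxy); split=> [/axis_inj//|].
  by rewrite axisM xy0 axis0.
rewrite !inE /=; have [->|/eqP x0] := eqVneq x 0; first by rewrite axis0 eqxx.
by apply/orP; right; apply/asboolP; exists x.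
Qed.

Lemma sum_card_axis_colors : (\sum_(i < n) #|axis_colors i| < #|T|)%N.
Proof.
have -> : (\sum_(i < n) #|axis_colors i|
           = #|\bigcup_(i < n) axis_colors i|)%SET%N.
  rewrite -sum1_card partition_disjoint_bigcup; last exact: axis_colors_disjoint.
  by apply: eq_bigr => i _; rewrite sum1_card.
rewrite -cardsT; apply/proper_card/properP; split; first exact: finset.subsetT.
exists (f 0); rewrite ?inE //; apply/finset.bigcupP => -[i _].
exact/negP/color0_notin_axis_colors.
Qed.

End AxisColors.

Lemma chromatic_number_prod_ge (k : 'I_n -> nat) (c : nat) :
  (forall i, chromatic_number_is (R i) (k i)) ->
  chromatic_number_is (prod_ring R) c -> (\sum_(i < n) k i < c + n)%N.
Proof.
move=> kP [[V /coloring_map_exists[f _ fcol]] _].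
have := sum_card_axis_colors fcol; rewrite card_ord -(ltn_add2r n).
apply: leq_ltn_trans.
rewrite -[X in (_ <= _ + X)%N]card_ord -sum1_card -big_split /=.
by apply: leq_sum => i _; rewrite addn1; exact: card_axis_colors.
Qed.

(** * The upper bound *)

Section ProductColoring.
Variables (k : 'I_n -> nat) (g : forall i, R i -> 'I_(k i)).
Arguments g : clear implicits.
Hypothesis gcol : forall i, coloring_map (g i).
Variable Z : forall i, {set 'I_(k i)}.
Hypothesis sqr0_Z : forall i (x : R i), x ^+ 2 = 0 -> g i x \in Z i.

Definition prod_color_type : finType :=
  ({i : 'I_n & 'I_(k i)} + {dffun forall i : 'I_n, 'I_(k i)})%type.

(** Any coordinate outside [Z] will do.  Recording it in the color ensures that
    elements of the same color are compared at the same coordinate. *)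
Definition prod_color (x : prod_ring R) : prod_color_type :=
  if [pick i | g i (x i) \notin Z i] is Some i
  then inl (Tagged (fun i => 'I_(k i)) (g i (x i)))
  else inr [ffun i => g i (x i)].

Definition prod_color_set : {set prod_color_type} :=
  [set t | match t with
           | inl p => tagged p \notin Z (tag p)
           | inr h => h \in setXn Z
           end]%SET.

Lemma prod_color_in x : prod_color x \in prod_color_set.
Proof.
rewrite inE /prod_color; case: pickP => [i|all_Z] //=.
by apply/setXnP => i; rewrite ffunE; have /negbFE := all_Z i.
Qed.

(** A color [inl] fixes a coordinate at which all products are nonzero, even
    squares; a color [inr] only yields this where the two elements differ, which
    they do somewhere. *)
Lemma prod_color_proper : coloring_map prod_color.
Proof.
move=> x y; rewrite /prod_color.
case: pickP => [i xi|_]; case: pickP => [l yl|_] // [].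
- move=> il; case: _ / il yl => yi /eqP.
  rewrite eq_Tagged /= => /eqP gxy [_ xy0].
  have xyi : x i * y i = 0 by rewrite -prod_ring_mulE xy0 prod_ring_zeroE.
  have [exy|/eqP nxy] := eqVneq (x i) (y i); last exact: gcol gxy (conj nxy xyi).
  by move/negP: xi; apply; apply: sqr0_Z; rewrite expr2 {2}exy.
- move=> /ffunP gxy [nxy xy0]; apply: nxy; apply/ffunP => i.
  have := gxy i; rewrite !ffunE => gi.
  have [//|/eqP ni] := eqVneq (x i) (y i).
  case: (gcol gi); split=> //.
  by rewrite -prod_ring_mulE xy0 prod_ring_zeroE.
Qed.

Lemma card_prod_color_set :
  #|prod_color_set| = (\sum_(i < n) (k i - #|Z i|) + \prod_(i < n) #|Z i|)%N.
Proof.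
rewrite -sum1_card big_sumType /= -cardsXn -sum1_card; congr (_ + _)%N.
  transitivity (\sum_(i < n) \sum_(m | m \notin Z i) 1)%N.
    by rewrite sig_big_dep; apply: eq_bigl => p; rewrite inE.
  apply: eq_bigr => i _; transitivity #|~: Z i|%SET.
    by rewrite -sum1_card; apply: eq_bigl => m; rewrite inE.
  by rewrite cardsCs finset.setCK card_ord.
by apply: eq_bigl => h; rewrite inE.
Qed.

End ProductColoring.

End Product.

Theorem corollary3p2 (n : nat) (hn : (1 <= n)%N) (R : 'I_n -> comPzRingType)
  (k : 'I_n -> nat) (hk : forall i, chromatic_number_is (R i) (k i))
  (U : forall i, 'I_(k i) -> set (R i))
  (hU : forall i, proper_coloring (U i))
  (s : 'I_n -> nat) (hs : forall i, s i = num_square_zero_classes (U i)) :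
  exists c : nat,
    [/\ chromatic_number_is (prod_ring R) c,
        \sum_(i < n) (k i)%:Z - (n%:Z - 1) <= c%:Z
      & c%:Z <= \sum_(i < n) ((k i)%:Z - (s i)%:Z) + \prod_(i < n) (s i)%:Z].
Proof.
pose Z i := [set m | `[< exists2 x, U i m x & x ^+ 2 = 0 >]]%SET.
have cardZ i : #|Z i| = s i by rewrite hs.
have mapP i : exists f : R i -> 'I_(k i),
    (forall x, U i (f x) x) /\ coloring_map f.
  by have [f fU fcol] := coloring_map_exists (hU i); exists f.
pose g i := projT1 (cid (mapP i)).
have gU i x : U i (g i x) x by have [+ _] := projT2 (cid (mapP i)); apply.
have gcol i : coloring_map (g i) by have [] := projT2 (cid (mapP i)).
have sqr0_Z i (x : R i) : x ^+ 2 = 0 -> g i x \in Z i.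
  by move=> x0; rewrite inE; apply/asboolP; exists x.
have pcol := prod_color_proper gcol sqr0_Z.
have [c cP] := chromatic_number_exists pcol.
exists c; split=> //.
  have := chromatic_number_prod_ge hk cP.
  by rewrite -(big_morph _ PoszD (erefl 0%:Z)); move: (\sum_(i < n) k i)%N; lia.
have := chromatic_number_le pcol (prod_color_in g Z) cP.
rewrite card_prod_color_set -lez_nat PoszD (big_morph _ PoszD (erefl 0%:Z)).
rewrite (big_morph _ PoszM (erefl 1%:Z)).
have -> : \sum_(i < n) ((k i)%:Z - (s i)%:Z) = \sum_(i < n) (k i - #|Z i|)%N%:Z.
  apply: eq_bigr => i _; rewrite cardZ subzn // -cardZ.
  by apply: leq_trans (max_card _) _; rewrite card_ord.
by under [X in _ + X]eq_bigr do rewrite cardZ.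
Qed.
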